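(* Let $\mathbb{F}$ be a field, let $n\ge 1$, let $s,d,D\in\mathbb{N}$, let $e\ge 1$ be an integer, and let $f,g\in\mathbb{F}[x_1,\ldots,x_n]$ with $f\neq 0$ satisfy \[ f=g^e,\qquad \|f\|_0\le s,\qquad \operatorname{indeg}(f)\le d,\qquad \operatorname{tdeg}(f)\le D . \] Then \[ \|g\|_0\le s^{D(2d+2)/e+1}. \]
   Context: For a polynomial $P$ over $\mathbb{F}$, $\|P\|_0$ denotes the number of monomials occurring in $P$ with nonzero coefficient. For nonzero $P\in\mathbb{F}[x_1,\ldots,x_n]$, $\operatorname{tdeg}(P)$ is the total degree (the maximum over monomials of $P$ of the sum of the exponents), and $\operatorname{indeg}(P)$ is the individual degree (the maximum exponent of any single variable in any monomial of $P$). The exponent $D(2d+2)/e+1$ is a real (rational) number; the inequality is between real numbers. *)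

(* Defs.v *)
From mathcomp Require Import all_boot all_order all_algebra.
From mathcomp Require Import mpoly.
From mathcomp Require Import reals exp.

Set Implicit Arguments.
Unset Strict Implicit.
Unset Printing Implicit Defensive.

Section Sparsity.
Variables (n : nat) (F : fieldType).
Implicit Type p : {mpoly F[n]}.

Definition sparsity p : nat := size (msupp p).

Definition indeg p : nat := (\max_(m <- msupp p) \max_(i < n) m i)%N.

(* The value at p = 0 is 0, by convention. *)
Definition tdeg p : nat := (\max_(m <- msupp p) mdeg m)%N.

Lemma tdegE p : tdeg p = (msize p).-1.
Proof.
rewrite /tdeg /mmeasure; elim: (msupp p) => [|m s IHs]; first by rewrite !big_nil.
by rewrite !big_cons IHs; case: (\max_(j <- s) _)%N => [|k]; rewrite ?maxn0 // maxnSS.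
Qed.

End Sparsity.

(* Main.v *)
(* Let b be an exponent of g with the largest Euclidean norm.  By
   Cauchy-Schwarz every other exponent m of g has a positive deficit
   <b,b> - <b,m>, so e b is an exponent of f = g ^ e.  If e is nonzero in F,
   comparing coefficients at m + (e - 1) b in the binomial expansion of
   (c x^b + h) ^ e shows, by induction on the deficit k of m, that
   m = b + (a_1 - e b) + ... + (a_k - e b) for some exponents a_j of f.
   Hence g has at most ||f|| ^ <b,b> monomials, and e <b,b> <= D d.  If e
   vanishes in F, the Frobenius map reduces e to e / p. *)
Require Import Defs.
From mathcomp Require Import all_boot all_order all_algebra.
From mathcomp Require Import mpoly.
From mathcomp Require Import reals exp.
From mathcomp Require Import zify.

Import Order.TTheory GRing.Theory Num.Theory.

(** * Scalar product of exponent vectors *)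

Section ScalarProduct.
Context {n : nat}.
Implicit Types b m : 'X_{1..n}.

Definition mdot b m : nat := \sum_(i < n) b i * m i.

Lemma mdot0 b : mdot b 0%MM = 0.
Proof. by apply: big1 => i _; rewrite mnmE muln0. Qed.

Lemma mdotD b m1 m2 : mdot b (m1 + m2)%MM = mdot b m1 + mdot b m2.
Proof.
by rewrite /mdot -big_split; apply: eq_bigr => i _; rewrite mnmDE mulnDr.
Qed.

Lemma mdotMn b m k : mdot b (m *+ k)%MM = mdot b m * k.
Proof.
by rewrite /mdot big_distrl; apply: eq_bigr => i _; rewrite mulmnE mulnA.
Qed.

(** Summing 2 b_i m_i <= b_i^2 + m_i^2, an equality only for b_i = m_i, gives 2 <b,m> < <b,b> +
    <m,m> <= 2 <b,b>. *)
Lemma mdot_lt b m : mdot m m <= mdot b b -> m != b -> mdot b m < mdot b b.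
Proof.
move=> le_mb neq_mb.
have [le2 eq2] := leqif_sum
  (fun (i : 'I_n) (_ : true) => nat_Cauchy (b i) (m i)).
have : [forall (i | true), b i == m i] = false.
  apply: contraNF neq_mb => /forallP eq_bm.
  by apply/eqP/mnmP => i; rewrite (eqP (eq_bm i)).
rewrite -eq2 => neq2.
have {le2 neq2} : \sum_i 2 * (b i * m i) < \sum_i (b i ^ 2 + m i ^ 2).
  by rewrite ltn_neqAle neq2.
rewrite -big_distrr big_split /=.
have sqE (v : 'X_{1..n}) : \sum_(i < n) v i ^ 2 = mdot v v by apply: eq_bigr => i _.
rewrite !sqE -/(mdot b m); lia.
Qed.

End ScalarProduct.

(** * Exponents occurring in powers of a polynomial over an integral domain *)

Section Supports.
Set Implicit Arguments.
Unset Strict Implicit.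
Context {n : nat} {R : idomainType}.
Implicit Types (p g : {mpoly R[n]}) (b m : 'X_{1..n}).

Definition msum (l : seq 'X_{1..n}) : 'X_{1..n} := (\sum_(v <- l) v)%MM.

Lemma msum_nseq k b : msum (nseq k b) = (b *+ k)%MM.
Proof.
apply/mnmP => i; rewrite /msum mnm_sumE mulmnE.
by rewrite big_nseq iter_addn addn0.
Qed.

(** Each member of [l] has deficit <b,b> - <b,v> at least 1, so the deficits add up to at least
    [size l]. *)
Lemma mdot_msum_lt b l : (forall v, v \in l -> mdot b v < mdot b b) ->
  mdot b (msum l) + size l <= mdot b b * size l.
Proof.
elim: l => [|v l IHl] lP; first by rewrite /msum big_nil mdot0.
have le_l := IHl (fun x xl => lP x (mem_behead (s := v :: l) xl)).
rewrite /msum big_cons mdotD /= mulnS addnS -addnA -addSn.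
by rewrite leq_add // lP // mem_head.
Qed.

Lemma msupp_exp p k m : m \in msupp (p ^+ k)%R ->
  exists l, [/\ size l = k, {subset l <= msupp p} & m = msum l].
Proof.
elim: k m => [|k IHk] m.
  rewrite expr0 msupp1 inE => /eqP ->.
  by exists [::]; rewrite /msum big_nil.
rewrite exprS => /msuppM_le /allpairsP [[u v] /= [uP /IHk [l [sz lP ->]] ->]].
exists (u :: l); split; rewrite /= ?sz //; last by rewrite /msum big_cons.
by move=> x; rewrite inE => /predU1P [->|/lP].
Qed.

Lemma mcoeff_monomial_expM c b j p m :
  (((c *: 'X_[b]) ^+ j * p)@_(m + b *+ j) = c ^+ j * p@_m)%R.
Proof.
by rewrite exprZn mpolyXn -scalerAl mcoeffZ -commr_mpolyX addmC mcoeffMX.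
Qed.

Lemma msupp_monomial_expM c b j p m :
  m \in msupp ((c *: 'X_[b]) ^+ j * p)%R ->
  exists2 u, u \in msupp p & m = (u + b *+ j)%MM.
Proof.
rewrite exprZn mpolyXn -scalerAl => /msuppZ_le /msuppM_le.
move=> /allpairsP [[u v] /= [+ vP ->]]; rewrite msuppX inE => /eqP ->.
by exists v => //; apply/mnmP => i; rewrite !mnmDE addnC.
Qed.

(** With g = c x^b + h, the term of g^e linear in h contributes e c^(e-1) h_m, which is nonzero, to
    the coefficient at m + (e-1) b, and the term free of h contributes nothing. Either the
    coefficient survives, or this exponent also occurs in a term with h^i, i >= 2; cancelling (e-i)
    b then writes m + (i-1) b as a sum of i exponents of h. *)
Lemma msupp_exp_step g e b m :
  (e%:R != 0 :> R)%R -> b \in msupp g -> m \in msupp g -> m != b ->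
  (m + b *+ e.-1)%MM \in msupp (g ^+ e)%R \/
  exists l, [/\ 2 <= size l, {subset l <= [predD1 msupp g & b]}
    & (m + b *+ (size l).-1)%MM = msum l].
Proof.
case: e => [|e]; first by rewrite eqxx.
move=> e_neq0 bP mP neq_mb; set c := (g@_b)%R.
set h := (g - c *: 'X_[b])%R.
have gE : g = (c *: 'X_[b] + h)%R by rewrite addrC subrK.
have hE v : (h@_v = if v == b then 0 else g@_v)%R.
  rewrite mcoeffB mcoeffZ mcoeffX eq_sym; case: eqP => [->|_].
    by rewrite mulr1 subrr.
  by rewrite mulr0 subr0.
have hP v : v \in msupp h -> v \in [predD1 msupp g & b].
  by rewrite inE /= !mcoeff_msupp hE; case: (v =P b); rewrite ?eqxx.
(* Here [e] is the predecessor of the original exponent, so [w] is the m + (e-1) b of the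
   statement. *)
pose w := (m + b *+ e)%MM.
pose T i := ((c *: 'X_[b]) ^+ (e.+1 - i) * h ^+ i : {mpoly R[n]})%R.
have [/existsP [i /andP [i_gt1 wP]]|/existsPn noT] :=
  boolP [exists i : 'I_e.+2, (1 < i) && (w \in msupp (T i))].
  right; have [u /msupp_exp [l [szl lP uE]] wE] := msupp_monomial_expM wP.
  exists l; split; rewrite ?szl //; first by move=> v /lP /hP.
  rewrite -uE; apply/mnmP => j; move/mnmP/(_ j): wE.
  rewrite !mnmDE !mulmnE; have := ltn_ord i; case: (i : nat) i_gt1 => // k _.
  rewrite !ltnS => le_ke /=.
  by rewrite subSS -{1}(subnKC le_ke) mulnDr addnA => /addIn.
left; rewrite mcoeff_msupp gE exprDn raddf_sum /=.
rewrite (bigD1 (inord 1)) //= big1 ?addr0; last first.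
  move=> i neq_i1; rewrite mcoeffMn.
  have [i_gt1|i_le1] := ltnP 1 i.
    have := noT i; rewrite i_gt1 /= mcoeff_msupp negbK => /eqP.
    by rewrite /T /w => ->; rewrite mul0rn.
  have i0 : i = 0 :> nat.
    move: neq_i1; rewrite -val_eqE /= inordK //; lia.
  (* The term free of h lives only at (e+1) b, which equals [w] only if m = b. *)
  rewrite i0 subn0 expr0 mulr1 exprZn mpolyXn mcoeffZ mcoeffX.
  case: eqP => [/mnmP bE|_]; last by rewrite mulr0 mul0rn.
  case/eqP: neq_mb; apply/mnmP => j; have := bE j.
  rewrite mnmDE !mulmnE mulnS; lia.
rewrite inordK // subn1 bin1 expr1 mcoeffMn mcoeff_monomial_expM hE.
rewrite (negPf neq_mb) -mulr_natr !mulf_neq0 ?expf_neq0 // -?mcoeff_msupp //.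
Qed.

(** A sum of e exponents of g has scalar product at most e <b,b> with b, with equality only if all
    of them are b. So the coefficient at e b is g_b^e, whatever the characteristic. *)
Lemma mem_msupp_exp_max g b e : b \in msupp g ->
  (forall m, m \in msupp g -> mdot m m <= mdot b b) ->
  (b *+ e)%MM \in msupp (g ^+ e)%R.
Proof.
move=> bP bmax; rewrite mcoeff_msupp.
suff ->: ((g ^+ e)@_(b *+ e) = g@_b ^+ e)%R.
  by rewrite expf_neq0 // -mcoeff_msupp.
set c := (g@_b)%R; set h := (g - c *: 'X_[b])%R.
have gE : g = (c *: 'X_[b] + h)%R by rewrite addrC subrK.
have hP v : v \in msupp h -> mdot b v < mdot b b.
  rewrite mcoeff_msupp mcoeffB mcoeffZ mcoeffX [b == v]eq_sym.
  case: (eqVneq v b) => [->|neq_vb]; first by rewrite mulr1 subrr eqxx.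
  by rewrite mulr0 subr0 -mcoeff_msupp => /bmax /mdot_lt; apply.
rewrite gE exprDn raddf_sum big_ord_recl /= big1 ?addr0 => [|i _].
  rewrite subn0 expr0 mulr1 bin0 mcoeffMn exprZn mpolyXn mcoeffZ mcoeffX.
  by rewrite eqxx mulr1.
rewrite mcoeffMn [X in (X *+ _)%R](_ : _ = 0%R) ?mul0rn //.
apply/eqP; rewrite -[_ == _]negbK -mcoeff_msupp; apply/negP.
move=> /msupp_monomial_expM [u /msupp_exp [l [szl lP ->]] /(congr1 (mdot b))].
rewrite mdotD !mdotMn => eq_dot.
have := mdot_msum_lt (fun v vl => hP v (lP v vl)).
rewrite szl /bump leq0n add1n in eq_dot *.
rewrite -{1}(subnKC (ltn_ord i)) mulnDr in eq_dot.
by rewrite -(addIn eq_dot); lia.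
Qed.

(** The representations of the members of [l] are concatenated: deficits and both sides of the
    identities are additive. It serves with a = e b and S the support of g^e. *)
Lemma msum_deficit (S : seq 'X_{1..n}) a b l :
  (forall m, m \in l -> exists t, [/\ {subset t <= S},
     size t + mdot b m = mdot b b & (m + a *+ size t = b + msum t)%MM]) ->
  exists t, [/\ {subset t <= S},
     size t + mdot b (msum l) = mdot b b * size l &
     (msum l + a *+ size t = b *+ size l + msum t)%MM].
Proof.
elim: l => [|m l IHl] lP.
  exists [::]; split=> [//||]; first by rewrite /msum big_nil mdot0 muln0.
  by apply/mnmP => i; rewrite !mnmDE !mulmnE !muln0 addnC.
have [x xl|t [tS szt tE]] := IHl; first by apply: lP; rewrite inE xl orbT.
have [u [uS szu uE]] := lP m (mem_head _ _).
exists (u ++ t); split; first by move=> x; rewrite mem_cat => /orP [/uS|/tS].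
  by rewrite /msum big_cons mdotD -/(msum _) size_cat /= mulnS -szt -szu addnACA.
apply/mnmP => i; move/mnmP/(_ i): uE; move/mnmP/(_ i): tE.
rewrite /msum big_cons big_cat !mnmDE !mulmnE size_cat /= mulnDr mulnS.
by lia.
Qed.

(** The identity m = b + (a_1 - e b) + ... + (a_k - e b) is written with the multiples of e b moved
    to the left, since subtraction of exponents is truncated. *)
Lemma msupp_exp_deficit g e b m : (e%:R != 0 :> R)%R -> b \in msupp g ->
  (forall v, v \in msupp g -> mdot v v <= mdot b b) -> m \in msupp g ->
  exists t, [/\ {subset t <= msupp (g ^+ e)%R},
    size t + mdot b m = mdot b b & (m + b *+ e *+ size t = b + msum t)%MM].
Proof.
move=> e_neq0 bP bmax.
have dotP v : v \in msupp g -> v != b -> mdot b v < mdot b b.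
  by move=> /bmax; apply: mdot_lt.
have [k] := ubnP (mdot b b - mdot b m); elim: k m => // k IHk m lt_mk mP.
have [->|neq_mb] := eqVneq m b.
  exists [::]; split => //; apply/mnmP => i.
  by rewrite /msum big_nil !mnmDE !mulmnE muln0.
have lt_mb := dotP m mP neq_mb.
have [mfP|[l [szl lP lE]]] := msupp_exp_step e_neq0 bP mP neq_mb.
  (* The single exponent a_1 = m + (e-1) b already gives m = b + (a_1 - e b); copies of e b add
     nothing and pad the list to the length of the deficit. *)
  exists ((m + b *+ e.-1)%MM ::
          nseq (mdot b b - mdot b m).-1 (b *+ e)%MM).
  split.
  - move=> v; rewrite inE => /predU1P [->//|/nseqP [-> _]].
    exact: mem_msupp_exp_max.
  - by rewrite /= size_nseq; lia.
  - rewrite /= size_nseq prednK ?subn_gt0 //; apply/mnmP => i.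
    rewrite /msum big_cons -/(msum _) msum_nseq !mnmDE !mulmnE.
    have e_gt0 : 0 < e by case: (posnP e) e_neq0 => // ->; rewrite eqxx.
    have beE : b i * e = b i + b i * e.-1 by rewrite -mulnS prednK.
    move: lt_mb; rewrite -subn_gt0; case: (_ - _) => // j _.
    by rewrite mulnS /=; lia.
(* By [dotE] the deficit of m is the sum of the deficits of the members of [l]. *)
have /(congr1 (mdot b)) := lE; rewrite mdotD mdotMn => dotE.
have [v vl|t [tS szt tE]] := @msum_deficit (msupp (g ^+ e)%R) (b *+ e)%MM b l.
  have /andP [neq_vb vP] := lP v vl.
  apply: IHk => //; rewrite -ltnS; apply: leq_trans lt_mk; rewrite ltnS.
  (* At least one other member of [l] remains and has positive deficit, so the deficit of v is
     smaller than that of m. *)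
  have remP x : x \in rem v l -> mdot b x < mdot b b.
    by move=> /mem_rem /lP /andP [neq_xb xP]; apply: dotP.
  have := mdot_msum_lt remP; rewrite size_rem //.
  move: dotE; rewrite {1}/msum (perm_big _ (perm_to_rem vl)) big_cons /=.
  rewrite mdotD -/(msum _); have := dotP v vP neq_vb.
  by case: (size l) szl => [|[|j]] // _; move: (_ * _); lia.
exists t; split=> //.
  move: szt; rewrite -dotE; case: (size l) szl => // j _.
  by rewrite mulnS /=; lia.
apply/mnmP => i; move/mnmP/(_ i): tE; move/mnmP/(_ i): lE.
rewrite !mnmDE !mulmnE; case: (size l) szl => // j _ /= <-.
by rewrite mulnS; lia.
Qed.

(** * Counting the exponents of a root *)

Lemma msum_cover (S : seq 'X_{1..n}) k :
  exists L, size L = size S ^ k /\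
    forall t, size t = k -> {subset t <= S} -> msum t \in L.
Proof.
elim: k => [|k [L [szL LP]]].
  by exists [:: 0%MM]; split=> // -[] // _ _; rewrite /msum big_nil mem_head.
exists [seq (u + v)%MM | u <- S, v <- L].
split=> [|[//|u t] /= [szt] tS]; first by rewrite size_allpairs szL expnS.
rewrite /msum big_cons; apply: allpairs_f; first exact: tS (mem_head _ _).
by apply: LP => // x xt; apply: tS; rewrite inE xt orbT.
Qed.

Lemma size_msupp_root_le g e b : (e%:R != 0 :> R)%R -> b \in msupp g ->
  (forall v, v \in msupp g -> mdot v v <= mdot b b) ->
  size (msupp g) <= size (msupp (g ^+ e)%R) ^ mdot b b.
Proof.
move=> e_neq0 bP bmax.
have [L [<- LP]] := msum_cover (msupp (g ^+ e)%R) (mdot b b).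
(* The truncated subtraction is exact on the sums that arise from exponents of g. *)
pose shift u := (b + u - b *+ e *+ mdot b b)%MM.
rewrite -(size_map shift L).
apply: uniq_leq_size (msupp_uniq _) _ => m mP.
have [t [tS szt tE]] := msupp_exp_deficit e_neq0 bP bmax mP.
(* Adding <b,m> copies of e b brings the length to <b,b> for every m, so that one map [shift]
   recovers each m from its sum. *)
apply/mapP; exists (msum (t ++ nseq (mdot b m) (b *+ e)%MM)).
  apply: LP; first by rewrite size_cat size_nseq.
  move=> v; rewrite mem_cat => /orP [/tS //|/nseqP [-> _]].
  exact: mem_msupp_exp_max.
apply/mnmP => i; move/mnmP/(_ i): tE.
rewrite /shift /msum big_cat -/(msum _) -/(msum _) msum_nseq.
rewrite mnmBE !mnmDE !mulmnE -szt mulnDr; lia.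
Qed.

End Supports.

(** * Frobenius powers and the reduction to e nonzero in the field *)

Section FieldRoots.
Context {n : nat} {F : fieldType}.
Implicit Types g : {mpoly F[n]}.

(** Additivity of the Frobenius map makes g^p the sum of the g_v^p x^(p v), and the exponents p v
    are distinct because p > 0. *)
Lemma msupp_exp_pchar g p m : p \in [pchar F]%R -> m \in msupp g ->
  (m *+ p)%MM \in msupp (g ^+ p)%R.
Proof.
move=> pF mP.
have pM : p \in [pchar {mpoly F[n]}]%R by rewrite pchar_lalg.
have p_gt0 : 0 < p by rewrite prime_gt0 // (pcharf_prime pF).
rewrite mcoeff_msupp -(pFrobenius_autE pM) {1}(mpolyE g) rmorph_sum raddf_sum /=.
rewrite (bigD1_seq m) ?msupp_uniq //= big1 => [|v neq_vm].
  rewrite addr0 pFrobenius_autE exprZn mpolyXn mcoeffZ mcoeffX eqxx mulr1.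
  by rewrite expf_neq0 // -mcoeff_msupp.
rewrite pFrobenius_autE exprZn mpolyXn mcoeffZ mcoeffX.
case: eqP => [/mnmP vmE|_]; last by rewrite mulr0.
case/eqP: neq_vm; apply/mnmP => i; have /eqP := vmE i.
by rewrite !mulmnE eqn_pmul2r // => /eqP.
Qed.

Lemma size_msupp_exp_pchar g p : p \in [pchar F]%R ->
  size (msupp g) <= size (msupp (g ^+ p)%R).
Proof.
move=> pF; rewrite -(size_map (fun m => (m *+ p)%MM)).
have p_gt0 : 0 < p by rewrite prime_gt0 // (pcharf_prime pF).
apply: uniq_leq_size => [|_ /mapP [m mP ->]]; last exact: msupp_exp_pchar.
rewrite map_inj_uniq ?msupp_uniq // => u v /mnmP uvE; apply/mnmP => i.
by have /eqP := uvE i; rewrite !mulmnE eqn_pmul2r // => /eqP.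
Qed.

Lemma exists_seq_max (T : eqType) (w : T -> nat) (s : seq T) : s != [::] ->
  exists2 x, x \in s & forall y, y \in s -> w y <= w x.
Proof.
elim: s => // x [_ _|y s /(_ isT) [z zs zmax] _].
  by exists x; rewrite ?mem_head // => y; rewrite inE => /eqP ->.
have [le_xz|lt_zx] := leqP (w x) (w z).
  exists z; first by rewrite inE zs orbT.
  by move=> v; rewrite inE => /predU1P [->|/zmax].
exists x; first exact: mem_head.
move=> v; rewrite inE => /predU1P [->//|/zmax le_vz].
exact: leq_trans le_vz (ltnW lt_zx).
Qed.

Lemma size_msupp_root_le_exists g e : 0 < e -> g != 0%R ->
  exists2 b, (b *+ e)%MM \in msupp (g ^+ e)%R &
    size (msupp g) <= size (msupp (g ^+ e)%R) ^ mdot b b.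
Proof.
have [k] := ubnP e; elim: k e => // k IHk e lt_ek e_gt0 g_neq0.
have [e0|e_neq0] := boolP (e%:R == 0 :> F)%R; last first.
  have [|b bP bmax] := exists_seq_max (fun m : 'X_{1..n} => mdot m m)
    (s := msupp g).
    by rewrite msupp_eq0.
  by exists b; [apply: mem_msupp_exp_max | apply: size_msupp_root_le].
have [p pF] := natf0_pchar e_gt0 e0.
(* The b found for e' also serves for e = e' p: raising g^e' to the power p multiplies its exponents
   by p and loses no monomial. *)
have /dvdnP [e' eE] : p %| e by rewrite (dvdn_pcharf pF).
have p_gt1 : 1 < p by rewrite prime_gt1 // (pcharf_prime pF).
have [||//|b bP le_g] := IHk e'; rewrite ?eE in lt_ek e_gt0 *; try nia.
have bE : (b *+ (e' * p) = b *+ e' *+ p)%MM.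
  by apply/mnmP => i; rewrite !mulmnE mulnA.
exists b; first by rewrite exprM bE; exact: msupp_exp_pchar.
apply: leq_trans le_g _; rewrite exprM.
by case: (mdot b b) => // j; rewrite leq_exp2r ?size_msupp_exp_pchar.
Qed.

End FieldRoots.

(** * Bounding <b,b> by the degrees of f and passing to real exponents *)

Theorem theorem3p4 (R : realType) (F : fieldType) (n : nat) (s d D e : nat)
    (f g : {mpoly F[n]}) :
  (1 <= n)%N -> (1 <= e)%N -> f != 0%R ->
  f = (g ^+ e)%R ->
  (sparsity f <= s)%N -> (indeg f <= d)%N -> (tdeg f <= D)%N ->
  ((sparsity g)%:R <= s%:R `^ (D%:R * (2 * d%:R + 2) / e%:R + 1) :> R)%R.
Proof.
move=> _ e_gt0 f_neq0 fE le_fs le_fd le_fD.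
have g_neq0 : g != 0%R.
  by apply: contraNneq f_neq0 => g0; rewrite fE g0 expr0n gtn_eqF.
have [b] := size_msupp_root_le_exists e_gt0 g_neq0; rewrite -fE => bP le_g.
(* Monotonicity of the real power in its exponent requires 1 <= s; the support of f is nonempty as
   it contains e b. *)
have s_gt0 : 0 < s.
  by apply: leq_trans le_fs; rewrite /sparsity; case: (msupp f) bP.
have le_bd i : b i * e <= d.
  rewrite -mulmnE; apply: leq_trans le_fd.
  apply: leq_trans (leq_bigmax_seq _ bP isT).
  exact: (leq_bigmax (F := fun i => (b *+ e)%MM i)).
have le_bD : (\sum_i b i) * e <= D.
  rewrite -mdegE -mdegMn; apply: leq_trans le_fD.
  exact: (leq_bigmax_seq _ bP isT).
(* One factor b_i of each square is bounded by b_i <= b_i e <= d; the other is summed to at most D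
   together with e. *)
have le_dot : mdot b b * e <= D * d.
  apply: leq_trans (leq_mul le_bD (leqnn d)).
  rewrite mulnAC !big_distrl /=; apply: leq_sum => i _.
  by rewrite !leq_mul // (leq_trans _ (le_bd i)) // leq_pmulr.
have le_gs : sparsity g <= s ^ mdot b b.
  by apply: leq_trans le_g _; case: (mdot b b) => // k; rewrite leq_exp2r.
apply: (@le_trans _ _ ((s ^ mdot b b)%N%:R)%R); first by rewrite ler_nat.
rewrite natrX -powR_mulrn ?ler0n //; apply: ler_powR; first by rewrite ler1n.
(* After comparing 0 with the summand 1 and clearing e, there remains <b,b> e <= D (2d+2), which
   follows from <b,b> e <= D d. *)
rewrite -[leLHS]addr0 lerD ?ler01 // ler_pdivlMr ?ltr0n //.
rewrite -!natrM -!natrD -natrM ler_nat; nia.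
Qed.
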